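(* Let $N\ge 1$, let $\mathcal{H}_1,\dots,\mathcal{H}_N$ be complex Hilbert spaces of finite dimensions $d_1,\dots,d_N$, and for each $k$ let $\{G^{(k)}_{\alpha}\}_{\alpha=0}^{d_k^2-1}$ be a canonical basis of $\mathcal{B}(\mathcal{H}_k)$. Let $\rho$ be a density operator on $\mathcal{H}_1\otimes\dots\otimes\mathcal{H}_N$, let $C^N_{\alpha_1\dots\alpha_N}=\mathrm{Tr}(\rho\,G^{(1)}_{\alpha_1}\otimes\dots\otimes G^{(N)}_{\alpha_N})$, and for real $x_1,\dots,x_N\ge 0$ let $$C^N_{i_1\dots i_N}(x_1,\dots,x_N)=C^N_{i_1\dots i_N}\,(D^1_{x_1})_{i_1i_1}\cdots(D^N_{x_N})_{i_Ni_N}.$$ If $\rho$ is fully separable, then $$\|C^N(x_1,\dots,x_N)\|_{\rm tr}\;\le\;\mathcal{N}_1(x_1)\cdots\mathcal{N}_N(x_N),\qquad \mathcal{N}_k(x_k)=\sqrt{\frac{d_k-1+x_k^2}{d_k}}\quad(k=1,\dots,N).$$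
   Context: A density operator is a positive semidefinite operator of trace one. A density operator on $\mathcal{H}_1\otimes\dots\otimes\mathcal{H}_N$ is fully separable if it is a finite convex combination of product states $\rho^1\otimes\dots\otimes\rho^N$ with each $\rho^k$ a density operator on $\mathcal{H}_k$. A canonical basis of $\mathcal{B}(\mathcal{H})$ (with $\dim\mathcal{H}=d$) is a basis $\{G_\alpha\}_{\alpha=0}^{d^2-1}$ of Hermitian operators, orthonormal for the Hilbert-Schmidt inner product $\langle X|Y\rangle_{\rm HS}=\mathrm{Tr}(X^\dagger Y)$, with $G_0=\mathbb{1}/\sqrt{d}$. $D^k_{x_k}=\mathrm{diag}\{x_k,1,\dots,1\}$ is the $d_k^2\times d_k^2$ diagonal matrix (the first entry corresponds to index $0$). Norms of $N$-tensors: for complex $N$-tensors $M^N,X^N$ of the same size, $\langle M^N|X^N\rangle_{\rm HS}=\sum_{i_1,\dots,i_N}\overline{M^N_{i_1\dots i_N}}\,X^N_{i_1\dots i_N}$. The spectral norm is $\|M^N\|_\infty=\sup\left|\sum_{i_1,\dots,i_N}M^N_{i_1\dots i_N}x^{(1)}_{i_1}\cdots x^{(N)}_{i_N}\right|$, the supremum being over complex vectors with $|x^{(1)}|=\dots=|x^{(N)}|=1$ (Euclidean norms). The trace norm of an $N$-tensor is $\|X^N\|_{\rm tr}=\sup_{M^N\neq 0}\frac{|\langle M^N|X^N\rangle_{\rm HS}|}{\|M^N\|_\infty}$, the supremum being over all nonzero complex $N$-tensors of the same size. *)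

(* Defs.v *)
From HB Require Import structures.
From mathcomp Require Export all_boot all_order all_algebra.
From mathcomp Require Export complex.
From mathcomp Require Export all_classical all_reals ereal.

Set Implicit Arguments.
Unset Strict Implicit.
Unset Printing Implicit Defensive.

Import Order.TTheory GRing.Theory Num.Theory.

Local Open Scope classical_set_scope.
Local Open Scope ring_scope.
Local Open Scope complex_scope.
Local Open Scope sesquilinear_scope.

(* Multi-indices (a_0, ..., a_{N-1}) with a_k < n k. *)
Notation mindex n := {dffun forall k, 'I_(n k)}.

(* A Hilbert space of dimension d is C^d, and its operators are the d x d
   complex matrices.  The product of the spaces C^(d k) has as orthonormal
   basis the product vectors indexed by [mindex d], enumerated by [enum_val]. *)
Notation tensop R d := 'M[R[i]]_#|mindex d|.

Section Operators.
Variable R : realType.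

Definition psdmx (m : nat) (A : 'M[R[i]]_m) : Prop :=
  forall v : 'cV[R[i]]_m, 0 <= (v^t* *m A *m v) 0 0.

Definition density (m : nat) (A : 'M[R[i]]_m) : Prop :=
  psdmx A /\ \tr A = 1.

Definition hs_mx (m : nat) (X Y : 'M[R[i]]_m) : R[i] := \tr (X^t* *m Y).

Definition tensprod (N : nat) (d : 'I_N -> nat)
    (A : forall k, 'M[R[i]]_(d k)) : tensop R d :=
  \matrix_(i, j) \prod_k A k ((enum_val i : mindex d) k)
                             ((enum_val j : mindex d) k).

Definition fully_separable (N : nat) (d : 'I_N -> nat)
    (rho : tensop R d) : Prop :=
  exists (m : nat) (p : 'I_m -> R) (s : 'I_m -> forall k, 'M[R[i]]_(d k)),
    [/\ forall j, 0 <= p j,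
        \sum_j p j = 1,
        forall j k, density (s j k)
      & rho = \sum_j (p j)%:C *: tensprod (s j)].

Definition canonical_basis (m : nat) (G : 'I_(m ^ 2) -> 'M[R[i]]_m) : Prop :=
  [/\ basis_of fullv (codom G),
      forall a, G a \is hermsymmx,
      forall a b, hs_mx (G a) (G b) = (a == b)%:R
    & forall a : 'I_(m ^ 2), a = 0%N :> nat -> G a = ((Num.sqrt m%:R)^-1)%:C%:M].

Definition Dmx (m : nat) (x : R) : 'M[R[i]]_(m ^ 2) :=
  diag_mx (\row_i (if i == 0%N :> nat then x%:C else 1)).

End Operators.

(* Complex N-tensors of size n_0 x ... x n_{N-1}. *)
Notation tensor R n := {ffun mindex n -> R[i]}.

Section Tensors.
Variables (R : realType) (N : nat) (n : 'I_N -> nat).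

Definition hs_tensor (M X : tensor R n) : R[i] :=
  \sum_(a : mindex n) (M a)^* * X a.

Definition enorm (m : nat) (x : 'rV[R[i]]_m) : R :=
  Num.sqrt (\sum_i Normc.normc (x 0 i) ^+ 2).

Definition spectral_norm (M : tensor R n) : R :=
  sup [set r : R | exists x : forall k, 'rV[R[i]]_(n k),
         (forall k, enorm (x k) = 1) /\
         r = Normc.normc (\sum_(a : mindex n) M a * \prod_k x k 0 (a k))].

(* The supremum is taken in the extended reals, so that a bound on the trace
   norm is a bound on every one of the quotients. *)
Definition trace_norm (X : tensor R n) : \bar R :=
  ereal_sup [set (Normc.normc (hs_tensor M X) / spectral_norm M)%:E
            | M in [set M : tensor R n | M != 0]].

End Tensors.

Section CorrelationTensor.
Variables (R : realType) (N : nat) (d : 'I_N -> nat).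

Definition corr_tensor (G : forall k, 'I_(d k ^ 2) -> 'M[R[i]]_(d k))
    (rho : tensop R d) : tensor R (fun k => d k ^ 2)%N :=
  [ffun a : mindex (fun k => d k ^ 2)%N =>
     \tr (rho *m tensprod (fun k => G k (a k)))].

Definition scaled_corr_tensor (G : forall k, 'I_(d k ^ 2) -> 'M[R[i]]_(d k))
    (rho : tensop R d) (x : 'I_N -> R) : tensor R (fun k => d k ^ 2)%N :=
  [ffun a : mindex (fun k => d k ^ 2)%N =>
     corr_tensor G rho a * \prod_k Dmx (d k) (x k) (a k) (a k)].

End CorrelationTensor.

(* Main.v *)
From mathcomp Require Import ring.
Require Import Defs.

Set Implicit Arguments.
Unset Strict Implicit.
Unset Printing Implicit Defensive.

Import Order.TTheory GRing.Theory Num.Theory.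
Local Open Scope ring_scope.
Local Open Scope sesquilinear_scope.

(* The scaled correlation tensor is linear in rho and factorizes on product
   states, so for a separable rho it is a convex combination of tensors
   v^1 (x) ... (x) v^N with v^k_a = Tr(s^k G_a) (D_x)_aa.  Pairing a tensor M
   with such a product gives at most ||M||_oo |v^1| ... |v^N| by homogeneity.
   Finally |v^k|^2 = sum_a |Tr(s^k G_a)|^2 + (x^2 - 1)|Tr(s^k G_0)|^2, where
   the first sum is at most Tr((s^k)^2) <= 1 by Bessel's inequality and
   |Tr(s^k G_0)|^2 = 1/d, hence |v^k|^2 <= (d - 1 + x^2)/d. *)

(** * Traces of products of tensor-product operators *)

Lemma bigA_distr_dffun (A : comPzSemiRingType) (I : finType) (T : I -> finType)
    (F : forall k, T k -> A) :
  \prod_k \sum_(j : T k) F k j =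
  \sum_(f : {dffun forall k, T k}) \prod_k F k (f k).
Proof.
(* An element of [fprod T] is an ordinary function into the tagged union of the [T k], so the
   non-dependent distributivity law applies there. *)
rewrite (reindex (@dffun_of_fprod _ T)); last exact/onW_bij/dffun_of_fprod_bij.
under [RHS]eq_bigr do under eq_bigr do rewrite ffunE.
pose P k := [ffun j => F k j].
transitivity (\sum_(t : fprod T) \prod_(i in I) P i (t i)); last first.
  by apply: eq_bigr => t _; apply: eq_bigr => k _; rewrite ffunE.
rewrite big_fprod.
transitivity (\prod_i \sum_(u in tagged_with T i) untag 0 (P i) u); last first.
  by rewrite (bigA_distr_big_dep (fun i => mem (tagged_with T i))
                                 (fun i => untag 0 (P i))).
apply: eq_bigr => k _; rewrite -(big_tag (fun i => P i)).
by apply: eq_bigr => j _; rewrite ffunE.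
Qed.

(** After reindexing along [enum_val], distributivity is used twice: for the diagonal sum of the
    trace and for the inner sum of the matrix product. *)
Lemma mxtrace_tensprod (R : realType) (N : nat) (d : 'I_N -> nat)
    (A B : forall k, 'M[R[i]]_(d k)) :
  \tr (tensprod A *m tensprod B) = \prod_k \tr (A k *m B k).
Proof.
have enum_bij := onW_bij (mem predT) (@enum_val_bij (mindex d)).
rewrite /mxtrace bigA_distr_dffun (reindex _ enum_bij) /=.
apply: eq_bigr => i _; rewrite mxE.
under [RHS]eq_bigr do rewrite mxE.
rewrite bigA_distr_dffun [RHS](reindex _ enum_bij) /=.
by apply: eq_bigr => j _; rewrite !mxE -big_split.
Qed.

(** * Entries of positive semidefinite matrices *)

Section PositiveSemidefinite.
Variables (C : numClosedFieldType) (m : nat) (A : 'M[C]_m).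
Hypothesis A_psd : forall v : 'cV[C]_m, 0 <= (v^t* *m A *m v) 0 0.

(** Positivity tested at [a *: delta_mx i 0 + b *: delta_mx j 0], with [i = j] allowed; the facts
    below come from particular choices of [a] and [b]. *)
Lemma psd_pair i j (a b : C) :
  0 <= a^* * a * A i i + a^* * b * A i j + b^* * a * A j i + b^* * b * A j j.
Proof.
move: (A_psd (a *: delta_mx i 0 + b *: delta_mx j 0)).
have -> : (a *: delta_mx i 0 + b *: delta_mx j 0 : 'cV[C]_m)^t* =
    a^* *: delta_mx 0 i + b^* *: delta_mx 0 j.
  apply/matrixP => k l.
  by rewrite !mxE rmorphD !rmorphM !rmorph_nat ![_ && (k == _)]andbC.
rewrite !mulmxDl !mulmxDr -!scalemxAl -!scalemxAr -!rowE -!colE !mxE.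
by rewrite !addrA !mulrA.
Qed.

Lemma psd_diag_ge0 i : 0 <= A i i.
Proof.
move: (psd_pair i i 1 0).
by rewrite rmorph0 rmorph1 !mul0r !mulr0 !mul0r !addr0 !mul1r.
Qed.

(** Over the complex numbers positivity forces hermiticity: the test coefficients [(1, 1)] and
    [(1, 'i)] make [A i j + A j i] and ['i * (A i j - A j i)] real, and these two relations combine
    to twice the claim. *)
Lemma psd_conj i j : A j i = (A i j)^*.
Proof.
have Ar k : A k k \is Num.real by rewrite ger0_real ?psd_diag_ge0.
have /CrealP h1 : A i j + A j i \is Num.real.
  have := ger0_real (psd_pair i j 1 1).
  rewrite rmorph1 !mul1r => h.
  rewrite (_ : _ + _ = A i i + A i j + A j i + A j j - A i i - A j j);
    last by ring.
  by rewrite !rpredB.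
have /CrealP h2 : 'i * (A i j - A j i) \is Num.real.
  have := ger0_real (psd_pair i j 1 'i).
  rewrite rmorph1 conjCi !mul1r !mulr1 !mulNr.
  rewrite -['i * 'i]expr2 sqrCi !mulN1r opprK => h.
  rewrite (_ : _ * _ =
    A i i + 'i * A i j - 'i * A j i + A j j - A i i - A j j); last by ring.
  by rewrite !rpredB.
move: h1 h2; rewrite rmorphM !(rmorphB, rmorphD) /= conjCi => h1.
rewrite mulNr -mulrN => /(mulfI (neq0Ci _)) h2.
apply/eqP; rewrite -subr_eq0.
have : (A j i - (A i j)^*) *+ 2 == 0.
  rewrite (_ : _ *+ 2 = (A i j + A j i - ((A i j)^* + (A j i)^*))
    - (A i j - A j i + ((A i j)^* - (A j i)^*))); last by ring.
  by rewrite h1 -h2; apply/eqP; ring.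
by rewrite mulrn_eq0.
Qed.

(* The form at [(t * A i j, b)] for real [t], [b]: take [t = A j j] and
   [b = - `|A i j| ^+ 2] if [A j j != 0], else [t = -1] and [b = A i i + 1]. *)
Lemma psd_minor i j : `|A i j| ^+ 2 <= A i i * A j j.
Proof.
have pair_z (t b : C) : t \is Num.real -> b \is Num.real ->
    0 <= t ^+ 2 * `|A i j| ^+ 2 * A i i + (t * b) * `|A i j| ^+ 2 *+ 2
         + b ^+ 2 * A j j.
  move=> /CrealP t_real /CrealP b_real.
  have := psd_pair i j (t * A i j) b.
  rewrite (psd_conj i j) rmorphM /= t_real b_real normCK.
  congr (0 <= _); ring.
have := psd_diag_ge0 i; have := psd_diag_ge0 j.
set z := `|A i j| ^+ 2 in pair_z *; set p := A i i in pair_z *.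
set q := A j j in pair_z *.
move=> q_ge0 p_ge0.
have z_ge0 : 0 <= z by rewrite exprn_ge0.
have [q0|q_neq0] := eqVneq q 0.
  have p1 : 0 < p + 1 by rewrite ltr_wpDl.
  have := pair_z (- 1) (p + 1); rewrite rpredN rpred1 ger0_real ?(ltW p1) // q0.
  rewrite !mulr0 addr0.
  move=> /(_ isT isT) h.
  have : z * (p + 2%:R) <= 0.
    by rewrite -oppr_ge0; congr (0 <= _): h; ring.
  by rewrite pmulr_lle0 // ltr_wpDl.
have q_gt0 : 0 < q by rewrite lt0r q_neq0.
have := pair_z q (- z); rewrite rpredN !ger0_real // => /(_ isT isT).
have [-> _|z_neq0] := eqVneq z 0; first exact: mulr_ge0.
rewrite (_ : _ + _ = (q * z) * (p * q - z)); last by ring.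
by rewrite pmulr_rge0 ?subr_ge0 // mulr_gt0 // lt0r z_neq0.
Qed.

End PositiveSemidefinite.

(** * Purity bound and Bessel's inequality for the Hilbert-Schmidt product *)

Section HilbertSchmidt.
Variables (C : numClosedFieldType) (m : nat).
Implicit Types X Y Z : 'M[C]_m.

Let hs X Y := \tr (X^t* *m Y).

Lemma hsE X Y : \tr (X^t* *m Y) = \sum_i \sum_j (X i j)^* * Y i j.
Proof.
rewrite exchange_big; apply: eq_bigr => i _; rewrite mxE.
by apply: eq_bigr => j _; rewrite !mxE.
Qed.

Lemma hs_normE X : \tr (X^t* *m X) = \sum_i \sum_j `|X i j| ^+ 2.
Proof.
rewrite hsE; apply: eq_bigr => i _; apply: eq_bigr => j _.
by rewrite normCK mulrC.
Qed.

Lemma hs_conj X Y : \tr (Y^t* *m X) = (\tr (X^t* *m Y))^*.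
Proof.
rewrite !hsE rmorph_sum; apply: eq_bigr => i _.
rewrite rmorph_sum; apply: eq_bigr => j _.
by rewrite rmorphM /= conjCK mulrC.
Qed.

(** The left side is the sum of all [|A i j|^2]; the 2 x 2 minors bound each term by
    [A i i * A j j], and these add up to the squared trace. *)
Lemma psd_hs_le (A : 'M[C]_m) :
  (forall v : 'cV[C]_m, 0 <= (v^t* *m A *m v) 0 0) ->
  \tr (A^t* *m A) <= \tr A ^+ 2.
Proof.
move=> A_psd; rewrite hs_normE expr2 {1}/mxtrace mulr_suml.
apply: ler_sum => i _; rewrite mulr_sumr; apply: ler_sum => j _.
exact: psd_minor.
Qed.

(* The residual [X - S] of the projection [S] of [X] is orthogonal to every
   [G a]. *)
Lemma bessel_hs (n : nat) (G : 'I_n -> 'M[C]_m) X :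
  (forall a b, \tr ((G a)^t* *m G b) = (a == b)%:R) ->
  \sum_a `|\tr ((G a)^t* *m X)| ^+ 2 <= \tr (X^t* *m X).
Proof.
move=> G_on; pose c a := hs (G a) X; pose S := \sum_a c a *: G a.
have hsBr Z Y Y' : hs Z (Y - Y') = hs Z Y - hs Z Y'.
  by rewrite /hs mulmxBr raddfB.
have hsSr Z : hs Z S = \sum_a c a * hs Z (G a).
  rewrite /hs /S mulmx_sumr raddf_sum; apply: eq_bigr => a _.
  by rewrite -scalemxAr; exact: mxtraceZ.
have G_perp a : hs (G a) (X - S) = 0.
  rewrite hsBr hsSr (bigD1 a) //= /hs G_on eqxx mulr1 big1 ?addr0 ?subrr //.
  by move=> b /negbTE ba; rewrite G_on eq_sym ba mulr0.
have : 0 <= hs (X - S) (X - S).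
  rewrite /hs hs_normE; apply: sumr_ge0 => i _; apply: sumr_ge0 => j _.
  exact: exprn_ge0.
have -> : hs (X - S) (X - S) = hs X (X - S).
  rewrite {1}/hs hs_conj -/(hs _ _) hsBr hsSr big1 ?subr0; last first.
    by move=> a _; rewrite /hs hs_conj -/(hs _ _) G_perp conjC0 mulr0.
  by rewrite /hs -hs_conj.
rewrite hsBr hsSr subr_ge0; congr (_ <= _); apply: eq_bigr => a _.
by rewrite normCK /c /hs -hs_conj.
Qed.

End HilbertSchmidt.

(** * Real-valued modulus and Euclidean norm *)

Section Norms.
Variable R : realType.
Local Notation normc := (@Normc.normc R).

Lemma normcE (z : R[i]) : `|z| = (normc z)%:C%C.
Proof. by []. Qed.

Lemma normc_ge0 (z : R[i]) : 0 <= normc z.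
Proof. by rewrite -ler0c -normcE. Qed.

Lemma normc_conj (z : R[i]) : normc (Num.conj z) = normc z.
Proof. by case: z => a b /=; rewrite sqrrN. Qed.

Lemma normc_sum (I : finType) (F : I -> R[i]) :
  normc (\sum_i F i) <= \sum_i normc (F i).
Proof.
rewrite -lecR -normcE rmorph_sum; apply: le_trans (ler_norm_sum _ _ _) _.
by [].
Qed.

Lemma normc_prod (I : finType) (F : I -> R[i]) :
  normc (\prod_i F i) = \prod_i normc (F i).
Proof. by apply: (big_morph _ (@Normc.normcM _) (Normc.normc1 _)). Qed.

Lemma normc_le_enorm p (v : 'rV[R[i]]_p) i : normc (v 0 i) <= enorm v.
Proof.
rewrite -[leLHS]ger0_norm ?normc_ge0 // -sqrtr_sqr ler_wsqrtr //.
by rewrite (bigD1 i) //= lerDl sumr_ge0 // => j _; rewrite exprn_ge0 ?normc_ge0.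
Qed.

Lemma enormZ p (c : R[i]) (v : 'rV[R[i]]_p) :
  enorm (c *: v) = normc c * enorm v.
Proof.
rewrite /enorm -[X in X * _]ger0_norm ?normc_ge0 // -sqrtr_sqr.
rewrite -sqrtrM ?sqr_ge0 // mulr_sumr; congr Num.sqrt; apply: eq_bigr => i _.
by rewrite mxE Normc.normcM exprMn.
Qed.

Lemma enorm_eq0 p (v : 'rV[R[i]]_p) : enorm v = 0 -> v = 0.
Proof.
move=> v0; apply/rowP => i; rewrite mxE; apply: Normc.eq0_normc.
by apply/eqP; rewrite eq_le normc_ge0 -v0 normc_le_enorm.
Qed.

Lemma enorm_conj p (v : 'rV[R[i]]_p) : enorm (map_mx Num.conj v) = enorm v.
Proof.
by congr Num.sqrt; apply: eq_bigr => i _; rewrite mxE normc_conj.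
Qed.

End Norms.

(** * The spectral norm as a bound on the multilinear form *)

Section SpectralNorm.
Variables (R : realType) (N : nat) (n : 'I_N -> nat).
Local Notation normc := (@Normc.normc R).
Implicit Types (M : tensor R n) (y : forall k, 'rV[R[i]]_(n k)).

Let eval M y := \sum_(a : mindex n) M a * \prod_k y k 0 (a k).

Lemma spectral_norm_ubound M y : (forall k, enorm (y k) = 1) ->
  normc (eval M y) <= spectral_norm M.
Proof.
move=> y1; apply: ub_le_sup; last by exists y.
(* The real [sup] dominates its members only if the set is bounded; it is, because coordinates of
   unit vectors have modulus at most 1. *)
exists (\sum_a normc (M a)) => _ [w [w1 ->]].
apply: le_trans (normc_sum _) _; apply: ler_sum => a _.
rewrite Normc.normcM normc_prod ler_piMr ?normc_ge0 // prodr_ile1 // => k _.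
by rewrite normc_ge0 -(w1 k) normc_le_enorm.
Qed.

Lemma spectral_norm_ge0 M : (forall k, 0 < n k)%N -> 0 <= spectral_norm M.
Proof.
move=> n_gt0.
pose e k : 'rV[R[i]]_(n k) := delta_mx 0 (Ordinal (n_gt0 k)).
have e1 k : enorm (e k) = 1.
  rewrite /enorm (bigD1 (Ordinal (n_gt0 k))) //= mxE !eqxx Normc.normc1 expr1n.
  rewrite big1 ?addr0 ?sqrtr1 // => j /negbTE jn.
  by rewrite mxE jn andbF Normc.normc0 expr0n.
exact: le_trans (normc_ge0 _) (spectral_norm_ubound M e1).
Qed.

Lemma spectral_norm_multilinear M y :
  normc (eval M y) <= (\prod_k enorm (y k)) * spectral_norm M.
Proof.
(* A zero vector cannot be normalized, but it makes both sides vanish. Otherwise every [y k] is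
   rescaled to a unit vector. *)
have [/existsP[k /eqP yk0]|/existsPn y_neq0] :=
  boolP [exists k, enorm (y k) == 0].
  rewrite (bigD1 k) //= yk0 !mul0r /eval big1 ?Normc.normc0 // => a _.
  by rewrite (bigD1 k) //= (enorm_eq0 yk0) mxE mul0r mulr0.
have y_gt0 k : 0 < enorm (y k) by rewrite lt0r y_neq0 sqrtr_ge0.
pose u k := (enorm (y k))^-1%:C%C *: y k.
have u1 k : enorm (u k) = 1.
  by rewrite enormZ /= expr0n addr0 sqrtr_sqr gtr0_norm ?invr_gt0 // mulVf.
have -> : eval M y = (\prod_k enorm (y k))%:C%C * eval M u.
  rewrite mulr_sumr; apply: eq_bigr => a _; rewrite mulrCA; congr (_ * _).
  rewrite rmorph_prod -big_split; apply: eq_bigr => k _ /=.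
  by rewrite mxE mulrA -rmorphM divff ?rmorph1 ?mul1r.
rewrite Normc.normcM /= expr0n addr0 sqrtr_sqr ger0_norm; last first.
  by apply: prodr_ge0 => k _; exact: ltW.
rewrite ler_wpM2l ?spectral_norm_ubound //.
by apply: prodr_ge0 => k _; exact: ltW.
Qed.

End SpectralNorm.

(** * One-site correlation vectors *)

Lemma enorm_corr_vector (R : realType) (m : nat) (G : 'I_(m ^ 2) -> 'M[R[i]]_m)
    (s : 'M[R[i]]_m) (x : R) :
  canonical_basis G -> density s ->
  enorm (\row_a (\tr (s *m G a) * Dmx m x a a)) <=
    Num.sqrt ((m%:R - 1 + x ^+ 2) / m%:R).
Proof.
move=> [_ G_herm G_on G0] [s_psd s_tr].
(* A 0 x 0 matrix has trace 0, hence is not a density operator. *)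
have m_gt0 : (0 < m)%N.
  case: m G s s_tr {G_herm G_on G0 s_psd} => // G s.
  by rewrite /mxtrace big_ord0 => /eqP; rewrite eq_sym oner_eq0.
have m2_gt0 : (0 < m ^ 2)%N by rewrite expn_gt0 m_gt0.
rewrite ler_wsqrtr //.
(* Hermiticity of [G a] turns the correlation into a Hilbert-Schmidt coefficient of [s], as Bessel's
   inequality requires. *)
have trE a : \tr (s *m G a) = \tr ((G a)^t* *m s).
  have /is_hermitianmxP := G_herm a; rewrite expr0 scale1r => <-.
  exact: mxtrace_mulC.
have bessel : \sum_a Normc.normc (\tr (s *m G a)) ^+ 2 <= 1.
  rewrite -lecR rmorph_sum /=.
  apply: le_trans (_ : \tr (s^t* *m s) <= _); last first.
    by apply: le_trans (psd_hs_le s_psd) _; rewrite s_tr expr1n.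
  apply: le_trans (bessel_hs s G_on); apply: ler_sum => a _.
  by rewrite trE rmorphXn.
pose z := Ordinal m2_gt0.
have c0 : Normc.normc (\tr (s *m G z)) ^+ 2 = m%:R^-1.
  rewrite G0 // mul_mx_scalar mxtraceZ s_tr mulr1 /= expr0n addr0 sqrtr_sqr.
  by rewrite real_normK ?num_real // exprVn sqr_sqrtr.
(* Only the entry at index 0 is rescaled by [Dmx], so it is split off both from the Bessel sum and
   from the goal. *)
rewrite (bigD1 z) //= in bessel *.
rewrite (bigD1 z) //= mxE Normc.normcM exprMn c0.
have -> : Normc.normc (Dmx m x z z) ^+ 2 = x ^+ 2.
  by rewrite !mxE !eqxx mulr1n /= expr0n addr0 sqrtr_sqr real_normK ?num_real.
rewrite (eq_bigr (fun a => Normc.normc (\tr (s *m G a)) ^+ 2)); last first.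
  move=> a; rewrite -val_eqE /= => /negbTE a_neq0.
  by rewrite !mxE eqxx a_neq0 mulr1.
have m0 : m%:R != 0 :> R by rewrite pnatr_eq0 -lt0n.
(* The first summand is the index-0 term; the second is what Bessel leaves for the other indices. *)
rewrite (_ : _ / _ = m%:R^-1 * x ^+ 2 + (1 - m%:R^-1)); last by field.
by rewrite lerD2l lerBrDl -c0.
Qed.

Lemma scaled_corr_tensor_separable (R : realType) (N : nat) (d : 'I_N -> nat)
    (G : forall k : 'I_N, 'I_(d k ^ 2) -> 'M[R[i]]_(d k))
    (x : 'I_N -> R) (m : nat) (p : 'I_m -> R[i])
    (s : 'I_m -> forall k, 'M[R[i]]_(d k)) a :
  scaled_corr_tensor G (\sum_j p j *: tensprod (s j)) x a =
  \sum_j p j * \prod_k (\tr (s j k *m G k (a k)) * Dmx (d k) (x k) (a k) (a k)).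
Proof.
rewrite !ffunE mulmx_suml raddf_sum mulr_suml; apply: eq_bigr => j _.
by rewrite big_split mulrA -mxtrace_tensprod -mxtraceZ scalemxAl.
Qed.

Theorem theorem2 (R : realType) (N : nat) (hN : (0 < N)%N) (d : 'I_N -> nat)
    (G : forall k : 'I_N, 'I_(d k ^ 2) -> 'M[R[i]]_(d k))
    (hG : forall k : 'I_N, canonical_basis (G k))
    (rho : tensop R d) (hrho : density rho)
    (x : 'I_N -> R) (hx : forall k : 'I_N, 0 <= x k)
    (hsep : fully_separable rho) :
  (trace_norm (scaled_corr_tensor G rho x) <=
   (\prod_(k < N) Num.sqrt (((d k)%:R - 1 + x k ^+ 2) / (d k)%:R))%:E)%E.
Proof.
case: hsep => m [p [s [p_ge0 p1 s_density ->]]].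
set B := \prod_(k < N) _.
have B_ge0 : 0 <= B by apply: prodr_ge0 => k _; exact: sqrtr_ge0.
apply: ge_ereal_sup => _ [M _ <-]; rewrite lee_fin.
(* Weights summing to 1 provide at least one product state, and its factor at site [k] has trace 1,
   so [d k] is nonzero. *)
have d_gt0 k : (0 < d k ^ 2)%N.
  rewrite expn_gt0 orbF lt0n; apply/eqP => dk0.
  case: m p s p_ge0 p1 s_density => [|m] p s _ p1 s_density.
    by move: p1; rewrite big_ord0 => /eqP; rewrite eq_sym oner_eq0.
  have [_ ] := s_density ord0 k.
  rewrite /mxtrace big1 => [/eqP|[l lk]]; first by rewrite eq_sym oner_eq0.
  by exfalso; rewrite dk0 in lk.
have M_ge0 := spectral_norm_ge0 M d_gt0.
set T := scaled_corr_tensor _ _ _.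
suff bound : Normc.normc (hs_tensor M T) <= B * spectral_norm M.
  (* If the spectral norm is 0, the quotient is 0 by the convention for inverses, and [B_ge0]
     suffices. *)
  have [->|M_neq0] := eqVneq (spectral_norm M) 0; first by rewrite invr0 mulr0.
  by rewrite ler_pdivrMr // lt0r M_neq0.
pose v j k : 'rV[R[i]]_(d k ^ 2) :=
  \row_a (\tr (s j k *m G k a) * Dmx (d k) (x k) a a).
(* The pairing conjugates [M] while the spectral norm does not; conjugating the whole form moves the
   conjugation to the vectors [v j k], whose norms are unchanged. *)
have -> : hs_tensor M T = \sum_j (p j)%:C%C *
    Num.conj (\sum_a M a * \prod_k (map_mx Num.conj (v j k)) 0 (a k)).
  rewrite /hs_tensor /T.
  under eq_bigr do rewrite scaled_corr_tensor_separable mulr_sumr.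
  rewrite exchange_big; apply: eq_bigr => j _ /=.
  rewrite rmorph_sum mulr_sumr; apply: eq_bigr => a _.
  rewrite mulrCA rmorphM; congr (_ * (_ * _)); rewrite rmorph_prod.
  by apply: eq_bigr => k _; rewrite !mxE; exact/esym/conjCK.
apply: le_trans (normc_sum _) _.
(* Writing 1 as the sum of the weights reduces the bound to one product state at a time. *)
rewrite -[B]mul1r -p1 !mulr_suml; apply: ler_sum => j _.
rewrite Normc.normcM /= expr0n addr0 sqrtr_sqr ger0_norm // -mulrA.
rewrite ler_wpM2l // normc_conj.
apply: le_trans (spectral_norm_multilinear M _) _.
rewrite ler_wpM2r // ler_prod // => k _.
by rewrite sqrtr_ge0 enorm_conj enorm_corr_vector.
Qed.
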